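(* Let $R$ be a nonzero ring (not necessarily commutative) and let $S$ be an index set (possibly infinite) with $|S| \geqslant 1$. Then the cardinality of the polynomial ring $R[x_k : k \in S]$ is $\aleph_0 \times |R| \times |S|$.
   Context: We work in ZFC; $|X|$ denotes the cardinality of a set $X$ and $\times$ between cardinals is the cardinal product. Rings are associative with identity. The polynomial ring $R[x_k : k\in S]$ is the monoid-ring $R[M]$ where $M = \bigoplus_{k\in S}\omega$ is the additive monoid of finitely supported functions $S \to \omega = \{0,1,2,\ldots\}$. *)

(* Defs.v *)
From HB Require Import structures.
From mathcomp Require Import all_boot all_order all_algebra.
From mathcomp Require Import boolp classical_sets functions cardinality.
From mathcomp Require Import finmap monalg.

Set Implicit Arguments.
Unset Strict Implicit.
Unset Printing Implicit Defensive.

(* [{cmonom S}] is the monoid of finitely supported functions S -> nat under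
   pointwise addition (written multiplicatively, as monomials), and
   [{malg R[M]}] is the monoid ring of M over R: the finitely supported
   functions M -> R with the convolution product.  The indeterminates commute
   with each other and with the coefficients, whether or not R is commutative. *)
Definition polyring (R : nzRingType) (S : choiceType) : nzRingType :=
  {malg R[{cmonom S}]}.

(* Main.v *)
(* Write X for nat * R * S.  Sending (n, r, s) to the polynomial r + x_s^(n+1)
   embeds X into the polynomial ring: the constant coefficient gives r back.
   Conversely a polynomial is determined by the finite list of its coefficients
   and monomials, and a monomial by the finite list of its variables and
   exponents.  As X is infinite, X * X embeds into X (a Zorn argument on partial
   injections A * A -> A), so finite lists over X embed into X, and hence so
   does the polynomial ring.  Cantor-Bernstein concludes. *)
Require Import Defs.
From HB Require Import structures.
From mathcomp Require Import all_boot all_order all_algebra.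
From mathcomp Require Import boolp classical_sets functions cardinality.
From mathcomp Require Import finmap monalg.

Local Open Scope classical_set_scope.
Local Open Scope card_scope.

(** * Zorn's lemma for partial functions *)

Definition inj_on {X Y : Type} (D : set X) (f : X -> Y) :=
  forall x y, D x -> D y -> f x = f y -> x = y.

Lemma inj_on_setX {X Y Z : Type} {A : set X} {B : set Y} {f : X * Y -> Z} :
  inj_on (A `*` B) f -> forall x y x' y', A x -> B y -> A x' -> B y' ->
  f (x, y) = f (x', y') -> x = x' /\ y = y'.
Proof.
move=> fI x y x' y' Ax By Ax' By' fxy.
by have [] := fI (x, y) (x', y') (conj Ax By) (conj Ax' By') fxy.
Qed.

(** A partial function is encoded as a domain with a total function whose values off the domain are
    ignored. Extension is then only a preorder, so maximality is phrased as a bound on the domain of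
    every extension. The pair [(D0, f0)] also bounds the empty chain. *)
Lemma Zorn_partial_fun (X Y : Type) (P : set X -> (X -> Y) -> Prop) D0 f0 :
    P D0 f0 ->
    (forall (C : set (set X * (X -> Y))) f, C !=set0 ->
      total_on C (fun p q => p.1 `<=` q.1) ->
      (forall p, C p -> P p.1 p.2) ->
      (forall p, C p -> forall x, p.1 x -> p.2 x = f x) ->
      P (\bigcup_(p in C) p.1) f) ->
  exists D f, P D f /\
    forall E g, P E g -> D `<=` E -> (forall x, D x -> f x = g x) -> E `<=` D.
Proof.
move=> P0 Pchain.
pose T := {p : set X * (X -> Y) | P p.1 p.2}.
pose R (p q : T) := `[< (sval p).1 `<=` (sval q).1 /\
  forall x, (sval p).1 x -> (sval p).2 x = (sval q).2 x >].
have [|p q r /asboolP[pq pqE] /asboolP[qr qrE]|A Atot|[[D f] /= Pf] maxf] :=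
  @ZL_preorder T (exist _ (D0, f0) P0) R.
- by move=> p; apply/asboolP; split.
- apply/asboolP; split; first exact: subset_trans qr.
  by move=> x px; rewrite pqE// qrE//; exact: pq.
- have [->|/set0P A0] := eqVneq A set0; first by exists (exist _ (D0, f0) P0).
  (* Members of a chain agree wherever both are defined, so a common value exists; outside the
     union, [f0 x] is a filler. *)
  have glue x : exists y, forall t, A t -> (sval t).1 x -> (sval t).2 x = y.
    have [[t At tx]|noA] := pselect (exists2 t, A t & (sval t).1 x).
      exists ((sval t).2 x) => u Au ux.
      by have [/asboolP[_ E]|/asboolP[_ E]] := Atot t u At Au; rewrite E.
    by exists (f0 x) => t At tx; case: noA; exists t.
  have [f fE] := choice glue.
  pose C := [set sval t | t in A].
  have Pf : P (\bigcup_(p in C) p.1) f.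
    apply: Pchain.
    + by have [t At] := A0; exists (sval t), t.
    + move=> _ _ [t At <-] [u Au <-].
      by have [/asboolP[]|/asboolP[]] := Atot t u At Au; [left|right].
    + by move=> _ [t At <-]; exact: (svalP t).
    + by move=> _ [t At <-] x tx; exact: fE.
  exists (exist _ (_, f) Pf) => s As; apply/asboolP; split => /=.
    by move=> x sx; exists (sval s) => //; exists s.
  by move=> x sx; exact: fE.
- exists D, f; split=> // E g Pg DE fg.
  suff /maxf/asboolP[] : R (exist _ (D, f) Pf) (exist _ (E, g) Pg) by [].
  by apply/asboolP; split.
Qed.

(** Any two points of the union already lie in the larger of two domains of the chain, where
    injectivity is known. *)
Lemma inj_on_chain (X Y : Type) (C : set (set X * (X -> Y))) f :
    total_on C (fun p q => p.1 `<=` q.1) ->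
    (forall p, C p -> inj_on p.1 p.2) ->
    (forall p, C p -> forall x, p.1 x -> p.2 x = f x) ->
  inj_on (\bigcup_(p in C) p.1) f.
Proof.
move=> Ctot CI fE x y [p Cp px] [q Cq qy].
wlog pq : x y p q Cp px Cq qy / p.1 `<=` q.1 => [H|].
  have [pq|qp fxy] := Ctot p q Cp Cq; first exact: (H x y p q).
  by apply/esym; exact: (H y x q p).
by rewrite -!(fE q Cq)//; [apply: CI => //; exact: pq|exact: pq].
Qed.

(** * Comparing cardinalities by injections *)

Lemma card_leTTP {T U : Type} :
  [set: T] #<= [set: U] <-> exists f : T -> U, injective f.
Proof.
split=> [|[f fI]].
  move=> /card_leP[f]; exists (fun x => val (f (to_setT x))) => x y /val_inj.
  by move=> /(@inj _ _ _ f)/=; move/(_ (mem_setT _) (mem_setT _))/(congr1 val).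
have /injfunPex[g] : exists2 g : T -> U, set_fun [set: T] [set: U] g & set_inj [set: T] g.
  by exists f => // x y _ _; exact: fI.
exact: inj_card_le g.
Qed.

Lemma pcard_le_injP {T : Type} {U : pointedType} {A : set T} {B : set U} :
  A #<= B <-> exists2 f : T -> U, set_fun A B f & inj_on A f.
Proof.
split=> [/pcard_leP/injfunPex[f fB fI]|[f fB fI]].
  by exists f => // x y Ax Ay; apply: fI; exact: mem_set.
have /injfunPex[g] : exists2 f : T -> U, set_fun A B f & set_inj A f.
  by exists f => // x y /set_mem Ax /set_mem Ay; exact: fI.
exact: inj_card_le g.
Qed.

(** A maximal partial injection from [A] to [B] is defined on all of [A] or hits all of [B]:
    otherwise one more pair [a], [b] could be added to it. *)
Lemma card_le_total {T U : Type} (A : set T) (B : set U) :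
  A #<= B \/ B #<= A.
Proof.
elim/Ppointed: T => T in A *; first by left; rewrite emptyE_subdef.
elim/Ppointed: U => U in B *; first by right; rewrite emptyE_subdef.
have [||D [f [[DA fB fI] maxD]]] := @Zorn_partial_fun T U
  (fun D f => [/\ D `<=` A, set_fun D B f & inj_on D f]) set0 (fun=> point).
- by split.
- move=> C f _ Ctot PC fE; split.
  + by move=> x [p Cp px]; have [+ _ _] := PC p Cp; exact.
  + by move=> x [p Cp px]; rewrite -(fE p)//; have [_ + _] := PC p Cp; exact.
  + by apply: inj_on_chain Ctot _ fE => p /PC[].
have [AD|/existsNP[a /not_implyP[Aa Da]]] := pselect (A `<=` D).
  left; apply/pcard_le_injP; exists f; first by move=> x /AD; exact: fB.
  by move=> x y /AD Dx /AD Dy; exact: fI.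
right; have [BD|/existsNP[b /not_implyP[Bb fDb]]] := pselect (B `<=` f @` D).
  apply: (card_le_trans (subset_card_le BD)).
  exact: card_le_trans (card_image_le f D) (subset_card_le DA).
pose g x := if x == a then b else f x.
have fg x : D x -> f x = g x.
  by move=> Dx; rewrite /g; case: eqP => // xa; move: Dx; rewrite xa.
case: Da; apply: (maxD (a |` D) g) => //; last by left.
split; first by move=> x [->|/DA].
- by move=> x [->|Dx]; rewrite /g ?eqxx// -/(g x) -fg//; exact: fB.
- move=> x y [->|Dx] [->|Dy] //.
  + by rewrite /g eqxx -/(g y) -fg// => bf; case: fDb; exists y.
  + by rewrite /g eqxx -/(g x) -fg// => bf; case: fDb; exists x.
  + by rewrite -!fg//; exact: fI.
Qed.

(** * Squares of infinite sets *)

Lemma card_le_setU {T : pointedType} {A B : set T} :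
  infinite_set A -> A `*` A #<= A -> B #<= A -> A `|` B #<= A.
Proof.
move=> Ainf /pcard_le_injP[f fA fI] /pcard_le_injP[h hA hI].
have [a0 Aa0] := infinite_setN0 Ainf.
have [a1 [Aa1 a10]] : exists a, A a /\ a <> a0.
  apply: contrapT => noA; apply: Ainf; apply: sub_finite_set (finite_set1 a0).
  by move=> a Aa; apply: contrapT => aa0; apply: noA; exists a.
(* The distinct tags [a0] and [a1] keep the image of [A] apart from that of the rest of [B]. *)
apply/pcard_le_injP; exists (fun x => if `[< A x >] then f (a0, x) else f (a1, h x)).
  by move=> x; case: asboolP => [Ax _|nAx [//|Bx]]; apply: fA; split=> //; exact: hA.
move=> x y ABx ABy.
have {}hA z : A z \/ B z -> ~ A z -> A (h z) by move=> [//|Bz] _; exact: hA.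
case: asboolP => Ax; case: asboolP => Ay.
- by move/(inj_on_setX fI) => [].
- by move/(inj_on_setX fI) => [] //; [exact: hA|move/esym].
- by move/(inj_on_setX fI) => [] //; exact: hA.
- move/(inj_on_setX fI) => [] //; [exact: hA|exact: hA|].
  by move=> _; apply: hI; [case: ABx|case: ABy].
Qed.

(** Take a maximal injection [f] of a square of an infinite set [A] into [A]. Were [A] embeddable
    into its complement, [f] would extend to a larger square. So by comparability the complement
    embeds into [A], and then so does [T]. *)
Lemma infinite_prod_inj {T : Type} :
  infinite_set [set: T] -> exists f : T * T -> T, injective f.
Proof.
elim/Ppointed: T => T Tinf; first by case: Tinf; rewrite emptyE.
have /infiniteP/card_leTTP[e eI] := Tinf.
have [h hN hI] : exists2 h : T -> nat, set_fun (range e) setT h & inj_on (range e) h.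
  exact/pcard_le_injP/card_image_le.
pose P (D : set (T * T)) f := exists A,
  [/\ D = A `*` A, infinite_set A, set_fun D A f & inj_on D f].
(* Zorn starts from a countable set: [h] numbers the range of [e], and [pickle] codes a pair of
   numbers by one number. *)
have [||D [f [[A [-> Ainf fA fI]] maxA]]] := @Zorn_partial_fun (T * T) T P
  (range e `*` range e) (fun p => e (choice.pickle (h p.1, h p.2))).
- exists (range e); split=> //.
  + apply/infiniteP/pcard_le_injP; exists e => [n _|m n _ _]; last exact: eI.
    by exists n.
  + move=> [x y] [x' y'] [/= ex ey] [/= ex' ey'].
    by move=> /eI/(pcan_inj choice.pickleK)[/hI-> // /hI->].
- move=> C f C0 Ctot PC fE.
  (* The side of a union of nested squares is read off the diagonal. *)
  exists [set x | exists2 p, C p & p.1 (x, x)]; split.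
  + apply/seteqP; split=> [[x y] [p Cp pxy]|].
      have [A [Ap _ _ _]] := PC p Cp; move: pxy; rewrite Ap => -[/= Ax Ay].
      by split; exists p => //; rewrite Ap.
    move=> [x y] [/= [p Cp px] [q Cq qy]].
    have [pq|qp] := Ctot p q Cp Cq.
      have [A [Aq _ _ _]] := PC q Cq; exists q => //.
      by move: qy (pq _ px); rewrite Aq => -[_ Ay] [Ax _].
    have [A [Ap _ _ _]] := PC p Cp; exists p => //.
    by move: px (qp _ qy); rewrite Ap => -[_ Ax] [Ay _].
  + have [p Cp] := C0; have [A [Ap Ainf _ _]] := PC p Cp.
    by apply: sub_infinite_set Ainf => x Ax; exists p => //; rewrite Ap.
  + move=> x [p Cp px]; have [A [Ap _ pA _]] := PC p Cp.
    by exists p => //; rewrite -(fE p Cp x px) Ap; split; exact: pA.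
  + by apply: inj_on_chain Ctot _ fE => p /PC[A []].
have sqA : A `*` A #<= A by apply/pcard_le_injP; exists f.
have [/pcard_le_injP[g gA gI]|] := card_le_total A (~` A); last first.
  (* Here [k] embeds all of [T] into [A], so [f] composed with [k] on both components is injective
     on [T * T]. *)
  move=> /(card_le_setU Ainf sqA)/pcard_le_injP[k kA kI].
  have kIT : injective k by move=> x y; apply: kI; rewrite setUv.
  exists (fun p => f (k p.1, k p.2)) => -[x y] [x' y'] /=.
  have AkT z : A (k z) by apply: kA; rewrite setUv.
  by move=> /(inj_on_setX fI) [] // /kIT-> /kIT->.
have /(card_le_setU Ainf sqA)/pcard_le_injP[k kA kI] := card_image_le g A.
set B := g @` A in kA kI.
(* The new pairs are sent into B, which is disjoint from A. *)
pose f' p := if `[< (A `*` A) p >] then f p else g (f (k p.1, k p.2)).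
have fk p : ((A `|` B) `*` (A `|` B)) p -> A (f (k p.1, k p.2)).
  by move=> [p1 p2]; apply: fA; split; exact: kA.
have AB : (A `|` B) `*` (A `|` B) `<=` A `*` A.
  apply: (maxA _ f').
  - exists (A `|` B); split => //.
    + by apply: sub_infinite_set Ainf; exact: subsetUl.
    + move=> p Ep; rewrite /f'; case: asboolP => Ap; first by left; exact: fA.
      by right; exists (f (k p.1, k p.2)) => //; exact: fk.
    + move=> p q Ep Eq; rewrite /f'.
      case: asboolP => Ap; case: asboolP => Aq.
      * exact: fI.
      * by move=> E; case: (gA _ (fk q Eq)); rewrite -E; exact: fA.
      * by move=> E; case: (gA _ (fk p Ep)); rewrite E; exact: fA.
      * move=> /(gI _ _ (fk p Ep) (fk q Eq)).
        case: p q Ep Eq {Ap Aq} => [x y] [x' y'] [/= Ex Ey] [/= Ex' Ey'].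
        by move=> /(inj_on_setX fI)[]; [exact: kA..|move=> /kI-> // /kI->].
  - by move=> p [p1 p2]; split; left.
  - by move=> p Ap; rewrite /f'; case: asboolP.
(* Maximality puts [g a] into [A], although [g] sends [A] into its complement. *)
have [a Aa] := infinite_setN0 Ainf.
have [|] := AB (g a, g a).
  by split; right; exists a.
by move=> /(gA a Aa).
Qed.

(** * Products and lists over an infinite set *)

Lemma card_le_prodTT (T U V : Type) : infinite_set [set: V] ->
  [set: T] #<= [set: V] -> [set: U] #<= [set: V] -> [set: T * U] #<= [set: V].
Proof.
move=> /infinite_prod_inj[f fI] /card_leTTP[g gI] /card_leTTP[h hI].
apply/card_leTTP; exists (fun p => f (g p.1, h p.2)) => -[x y] [x' y'] /=.
by move=> /fI[/gI-> /hI->].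
Qed.

(** Lists are coded by iterating the pairing [f]; the tags [e 0] and [e 1] tell the empty list from
    a cons. *)
Lemma card_le_seqTT (T V : Type) : infinite_set [set: V] ->
  [set: T] #<= [set: V] -> [set: seq T] #<= [set: V].
Proof.
move=> Vinf /card_leTTP[g gI].
have [f fI] := infinite_prod_inj Vinf; have /infiniteP/card_leTTP[e eI] := Vinf.
apply/card_leTTP.
exists (foldr (fun x v => f (e 1%N, f (g x, v))) (f (e 0%N, e 0%N))).
elim=> [|x s IH] [|y t] //=.
- by move=> /fI[/eI].
- by move=> /fI[/eI].
- by move=> /fI[/fI[/gI-> /IH->]].
Qed.

(** * Finitely supported functions and polynomials *)

Lemma card_le_fsfun (K : choiceType) (U : eqType) (d : K -> U) :
  [set: {fsfun K -> U for d}] #<= [set: seq (K * U)].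
Proof.
apply/card_leTTP.
exists (fun p : {fsfun K -> U for d} => [seq (k, p k) | k <- finsupp p]) => p q pq.
(* The keys of the list are the support, so equal lists give equal supports, off which both
   functions take the default [d]. *)
have pqs : finsupp p = finsupp q :> seq K.
  by move: (congr1 (map fst) pq); rewrite -!map_comp !map_id.
apply/fsfunP => k; case: (finsuppP p k) => kp.
  by rewrite fsfun_dflt// -[_ \in _]/(k \in (finsupp q : seq K)) -pqs.
have : (k, p k) \in [seq (k, p k) | k <- finsupp p] by exact: map_f.
by rewrite pq => /mapP[k' _ [-> ->]].
Qed.

(** The coefficient at [k0] gives [r = s]. After cancelling, the coefficient at [k] is 1 on the
    left, and 1 is nonzero in [R], which forces [l = k]. *)
Lemma malgUD_inj {K : choiceType} {R : nzRingType} {k0 k l : K} {r s : R} :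
    k != k0 -> l != k0 ->
    (<< r *g k0 >> + << k >> = << s *g k0 >> + << l >> :> {malg R[K]})%R ->
  r = s /\ k = l.
Proof.
move=> /negbTE kk0 /negbTE lk0 E.
have rs : r = s.
  move: (congr1 (mcoeff k0) E).
  by rewrite !mcoeffD !mcoeffUU !mcoeffU kk0 lk0 !GRing.addr0.
split=> //; move: E; rewrite rs => /GRing.addrI/(congr1 (mcoeff k))/eqP.
rewrite !mcoeffU eqxx; case: (l =P k) => // _.
by rewrite GRing.oner_eq0.
Qed.

Theorem corollary4p9 (R : nzRingType) (S : choiceType)
    (hS : `I_1 #<= [set: S]) :
  [set: polyring R S] #= [set: nat] `*` [set: R] `*` [set: S].
Proof.
rewrite !setXTT.
have [s0 _] : [set: S] !=set0.
  apply/set0P; apply: contraTneq hS => ->; rewrite card_le0.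
  by apply/set0P; exists 0%N.
pose X := (nat * R * S)%type.
have natX : [set: nat] #<= [set: X].
  by apply/card_leTTP; exists (fun n => (n, 0%R, s0)) => m n [].
have RX : [set: R] #<= [set: X].
  by apply/card_leTTP; exists (fun r => (0%N, r, s0)) => m n [].
have SX : [set: S] #<= [set: X].
  by apply/card_leTTP; exists (fun s => (0%N, 0%R, s)) => m n [].
have Xinf : infinite_set [set: X] by exact/infiniteP.
rewrite card_eq_le; apply/andP; split.
- have MX : [set: {cmonom S}] #<= [set: X].
    have cmI : [set: {cmonom S}] #<= [set: {fsfun S -> nat for fun=> 0%N}].
      by apply/card_leTTP; exists (@cmonom_val S); exact: val_inj.
    apply: (card_le_trans cmI); apply: (card_le_trans (card_le_fsfun _ _ _)).
    by apply: card_le_seqTT => //; exact: card_le_prodTT.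
  have mI : [set: polyring R S] #<= [set: {fsfun {cmonom S} -> R for fun=> 0%R}].
    by apply/card_leTTP; exists (@malg_val _ R); exact: val_inj.
  apply: (card_le_trans mI); apply: (card_le_trans (card_le_fsfun _ _ _)).
  by apply: card_le_seqTT => //; exact: card_le_prodTT.
(* The exponent [n.+1] keeps the monomial different from [mone] even when [n] is 0. *)
- have [mon monE] : exists mon : nat -> S -> {cmonom S},
      forall n s t, mon n s t = if t == s then n.+1 else 0%N.
    exists (fun n s => [cmonom n.+1 | _ in fset1 s]%M) => n s t.
    by rewrite cmE fsfun_fun in_fsetE.
  have mon1 n s : mon n s != mone.
    by apply/negP => /cmP/(_ s); rewrite monE eqxx cm1.
  apply/card_leTTP.
  exists (fun p : X => <<p.1.2 *g mone>> + << mon p.1.1 p.2 >> : {malg R[{cmonom S}]})%R.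
  move=> [[m r] s] [[n r'] t] /= /(malgUD_inj (mon1 _ _) (mon1 _ _)) [-> mn].
  (* The exponent at [s] is the nonzero [m.+1] on the left, so [s = t], and then [m = n]. *)
  move: (congr1 (fun M : {cmonom S} => M s) mn); rewrite !monE eqxx.
  by case: eqP => // <- [<-].
Qed.
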